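(* Let $V\subseteq\mathbb{R}^n$ be a non-empty convex set and let $Q_1,Q_2:V\to\mathbb{R}$ be $GS$-exponential kind of convex functions associated with maps $G_1,G_2:V\times V\times(0,1]\to\mathbb{R}$ respectively. Then $Q_1+Q_2$ is a $GS$-exponential kind of convex function, and for every real $\beta\ge 0$ the function $\beta Q_1$ is a $GS$-exponential kind of convex function.
   Context: Fix $s\in(0,1]$ (the same $s$ for all functions). Let $V\subseteq\mathbb{R}^n$ be a non-empty convex set. A function $Q:V\to\mathbb{R}$ is a $GS$-exponential kind of convex function on $V$ associated with the map $G:V\times V\times(0,1]\to\mathbb{R}$ if $$Q(am_1+(1-a)m_2)\le (e^a-1)^sQ(m_1)+(e^{1-a}-1)^sQ(m_2)+aG(m_1,m_2,s)$$ for all $m_1,m_2\in V$ and all $a\in[0,1]$. $Q$ is called a $GS$-exponential kind of convex function (no map mentioned) if it is one associated with some such map $G$. *)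

(* Defs.v *)
From mathcomp Require Import all_boot all_order all_algebra.
From mathcomp Require Import all_classical all_reals all_analysis.

Set Implicit Arguments.
Unset Strict Implicit.
Unset Printing Implicit Defensive.

Import Order.TTheory GRing.Theory Num.Theory.

Local Open Scope classical_set_scope.
Local Open Scope ring_scope.

(* Functions on V (resp. on V x V x (0,1]) are total functions of which only
   the values on V (resp. V x V x (0,1]) are constrained.  For 0 <= a <= 1 and
   0 < s, both bases of the real powers are >= 0 and powR gives 0 `^ s = 0. *)
Definition GS_exp_convex_with (R : realType) (n : nat) (s : R)
    (V : set 'rV[R]_n) (Q : 'rV[R]_n -> R)
    (G : 'rV[R]_n -> 'rV[R]_n -> R -> R) : Prop :=
  forall (m1 m2 : 'rV[R]_n) (a : R), V m1 -> V m2 -> 0 <= a <= 1 ->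
    Q (a *: m1 + (1 - a) *: m2)
      <= (expR a - 1) `^ s * Q m1 + (expR (1 - a) - 1) `^ s * Q m2
         + a * G m1 m2 s.

Definition GS_exp_convex (R : realType) (n : nat) (s : R)
    (V : set 'rV[R]_n) (Q : 'rV[R]_n -> R) : Prop :=
  exists G : 'rV[R]_n -> 'rV[R]_n -> R -> R, GS_exp_convex_with s V Q G.

(* Main.v *)
Require Import Defs.
From mathcomp Require Import all_boot all_order all_algebra.
From mathcomp Require Import all_classical all_reals all_analysis.
From mathcomp Require Import ring.

Import Order.TTheory GRing.Theory Num.Theory.

Local Open Scope classical_set_scope.
Local Open Scope ring_scope.

(** The defining inequality is linear in the pair (Q, G) jointly, because the
    weights on Q m1, Q m2 and G m1 m2 s depend on a and s only.  So the pairs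
    that satisfy it form a convex cone: [GS_exp_convex_withD] adds two
    inequalities and [GS_exp_convex_withZ] multiplies one by a nonnegative
    scalar.  This yields G1 + G2 and beta * G1 as the associated maps. *)

Lemma GS_exp_convex_withD (R : realType) (n : nat) (s : R)
    (V : set 'rV[R]_n) (Q1 Q2 : 'rV[R]_n -> R)
    (G1 G2 : 'rV[R]_n -> 'rV[R]_n -> R -> R) :
  GS_exp_convex_with s V Q1 G1 -> GS_exp_convex_with s V Q2 G2 ->
  GS_exp_convex_with s V (fun x => Q1 x + Q2 x)
    (fun x y t => G1 x y t + G2 x y t).
Proof.
move=> hQ1 hQ2 m1 m2 a Vm1 Vm2 a01.
apply: le_trans (lerD (hQ1 _ _ _ Vm1 Vm2 a01) (hQ2 _ _ _ Vm1 Vm2 a01)) _.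
by rewrite le_eqVlt; apply/orP; left; apply/eqP; ring.
Qed.

Lemma GS_exp_convex_withZ (R : realType) (n : nat) (s : R)
    (V : set 'rV[R]_n) (Q : 'rV[R]_n -> R)
    (G : 'rV[R]_n -> 'rV[R]_n -> R -> R) (beta : R) :
  0 <= beta -> GS_exp_convex_with s V Q G ->
  GS_exp_convex_with s V (fun x => beta * Q x) (fun x y t => beta * G x y t).
Proof.
move=> beta0 hQ m1 m2 a Vm1 Vm2 a01.
apply: le_trans (ler_wpM2l beta0 (hQ _ _ _ Vm1 Vm2 a01)) _.
by rewrite le_eqVlt; apply/orP; left; apply/eqP; ring.
Qed.

Theorem theorem3p2 (R : realType) (n : nat) (s : R) (hs : 0 < s <= 1)
    (V : set 'rV[R]_n) (V_nonempty : V !=set0) (V_convex : convex_set V)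
    (Q1 Q2 : 'rV[R]_n -> R) (G1 G2 : 'rV[R]_n -> 'rV[R]_n -> R -> R)
    (hQ1 : GS_exp_convex_with s V Q1 G1)
    (hQ2 : GS_exp_convex_with s V Q2 G2) :
  GS_exp_convex s V (fun x => Q1 x + Q2 x) /\
  (forall beta : R, 0 <= beta -> GS_exp_convex s V (fun x => beta * Q1 x)).
Proof.
split=> [|beta beta0]; eexists.
  exact: GS_exp_convex_withD hQ1 hQ2.
exact: GS_exp_convex_withZ beta0 hQ1.
Qed.
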